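(* Let $F,G\in\mathcal{F}^{n\times n}$ with $F$ singular and $sF-G$ a regular pencil, and let $B\in\mathcal{F}^{n\times l}$, $C\in\mathcal{F}^{m\times n}$, $k_0\in\mathbb{Z}$. Consider the system $$FY_{k+1}=GY_k+BV_k,\qquad X_k=CY_k,\qquad k\ge k_0,$$ and let $H_q$, $Q_q$, $B_q$, $q_*$ be the Weierstrass data described in the context. Then the system is causal between output and inputs if and only if every column of the matrix $$\begin{bmatrix}Q_qH_qB_q & Q_qH_q^2B_q&\cdots & Q_qH_q^{q_*-1}B_q\end{bmatrix}$$ lies in the right nullspace $\{v\in\mathcal{F}^n: Cv=0\}$ of the matrix $C$.
   Context: $\mathcal{F}$ is a field over which the Weierstrass decomposition below exists (e.g. $\mathcal{F}=\mathbb{C}$). The pencil $sF-G$ is regular if $\det(sF-G)$ is not the zero polynomial in the indeterminate $s$. $Y_k\in\mathcal{F}^n$ is the state, $V_k\in\mathcal{F}^l$ the input (an arbitrary sequence $(V_k)_{k\ge k_0}$), and $X_k\in\mathcal{F}^m$ the output. Causality between output and inputs: for every $k>k_0$ the output $X_k$ is completely determined by the initial state $Y_{k_0}$ and the former inputs $V_{k_0},V_{k_0+1},\dots,V_k$. That is, if two solutions $(Y_k)$, $(Y_k')$ of the system correspond to input sequences $(V_k)$, $(V_k')$ with $Y_{k_0}=Y'_{k_0}$ and $V_i=V_i'$ for $k_0\le i\le k$, then $CY_k=CY'_k$. Weierstrass data: by regularity there are nonsingular $P,Q\in\mathcal{F}^{n\times n}$ with $PFQ=I_p\oplus H_q$ and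 $PGQ=J_p\oplus I_q$, where $p+q=n$ and $\oplus$ denotes block-diagonal direct sum. Here $J_p$ is a direct sum of Jordan blocks for the finite eigenvalues of the pencil, and $H_q$ is a direct sum of nilpotent Jordan blocks (ones on the superdiagonal, zeros elsewhere). The number $q_*$ is the nilpotency index of $H_q$, i.e. its largest block size. Such $P,Q$ are fixed. Write $Q=[\,Q_p\ \ Q_q\,]$ with $Q_p\in\mathcal{F}^{n\times p}$, $Q_q\in\mathcal{F}^{n\times q}$, and $PB=\begin{bmatrix} B_p \\ B_q \end{bmatrix}$ with $B_p\in\mathcal{F}^{p\times l}$, $B_q\in\mathcal{F}^{q\times l}$. If $q_*=1$ the displayed matrix has no columns and the condition is vacuously true. *)

(* Defs.v *)
From mathcomp Require Import all_boot all_order all_algebra.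

Set Implicit Arguments.
Unset Strict Implicit.
Unset Printing Implicit Defensive.

Import Order.TTheory GRing.Theory Num.Theory.
Local Open Scope ring_scope.

Definition pencil (K : fieldType) (n : nat) (F G : 'M[K]_n) : 'M[{poly K}]_n :=
  'X *: map_mx polyC F - map_mx polyC G.

Definition regular_pencil (K : fieldType) (n : nat) (F G : 'M[K]_n) : Prop :=
  \det (pencil F G) != 0.

Definition finite_eigenvalue (K : fieldType) (n : nat) (F G : 'M[K]_n) (a : K) :
  Prop := root (\det (pencil F G)) a.

Definition jordan_block (K : fieldType) (a : K) (n : nat) : 'M[K]_n :=
  \matrix_(i, j) (a *+ (i == j) + ((j : nat) == i.+1)%:R).

(* The block sizes are positive, but [wp] and [wq] may vanish (no finite, resp.
   no infinite, eigenvalue).  [wn] identifies the size [n] of the pencil with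
   [p + q], and the casts along it only serve to write n x n matrices in block
   form. *)
Record weierstrass (K : fieldType) (n : nat) (F G : 'M[K]_n) := Weierstrass {
  wnp : nat;
  wpsize : 'I_wnp -> nat;
  weig : 'I_wnp -> K;
  wnq : nat;
  wqsize : 'I_wnq -> nat;
  wp := (\sum_(i < wnp) wpsize i)%N;
  wq := (\sum_(i < wnq) wqsize i)%N;
  wJ : 'M[K]_wp := \mxdiag_(i < wnp) jordan_block (weig i) (wpsize i);
  wH : 'M[K]_wq := \mxdiag_(i < wnq) jordan_block 0 (wqsize i);
  wn : (n = wp + wq)%N;
  wP : 'M[K]_n;
  wQ : 'M[K]_n;
  wpsize_gt0 : forall i, (0 < wpsize i)%N;
  wqsize_gt0 : forall i, (0 < wqsize i)%N;
  weigP : forall i, finite_eigenvalue F G (weig i);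
  wP_unit : wP \in unitmx;
  wQ_unit : wQ \in unitmx;
  wPFQ : castmx (wn, wn) (wP *m F *m wQ) = block_mx 1%:M 0 0 wH;
  wPGQ : castmx (wn, wn) (wP *m G *m wQ) = block_mx wJ 0 0 1%:M
}.

Arguments wpsize {K n F G} w i.
Arguments weig {K n F G} w i.
Arguments wqsize {K n F G} w i.
Arguments wpsize_gt0 {K n F G} w i.
Arguments wqsize_gt0 {K n F G} w i.
Arguments weigP {K n F G} w i.

Section WeierstrassData.
Variables (K : fieldType) (n l : nat) (F G : 'M[K]_n).
Variables (W : weierstrass F G) (B : 'M[K]_(n, l)).

Definition wQq : 'M[K]_(n, wq W) := rsubmx (castmx (erefl n, wn W) (wQ W)).

Definition wBq : 'M[K]_(wq W, l) := dsubmx (castmx (wn W, erefl l) (wP W *m B)).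

(* The largest block size of H_q; [wqstar_nilpotency_index] below shows that it
   is the nilpotency index of H_q. *)
Definition wqstar : nat := \max_(i < wnq W) wqsize W i.

Definition causality_mx : 'M[K]_(n, \sum_(i < wqstar.-1) l) :=
  \mxrow_(i < wqstar.-1) (wQq *m wH W ^+ i.+1 *m wBq).

End WeierstrassData.

(* Sequences are indexed by all of [int]; only their values at k >= k0 matter. *)
Definition is_solution (K : fieldType) (n l : nat) (F G : 'M[K]_n)
    (B : 'M[K]_(n, l)) (k0 : int) (V : int -> 'cV[K]_l) (Y : int -> 'cV[K]_n) :
    Prop :=
  forall k : int, k0 <= k -> F *m Y (k + 1) = G *m Y k + B *m V k.

Definition causal_output_input (K : fieldType) (n l m : nat) (F G : 'M[K]_n)
    (B : 'M[K]_(n, l)) (C : 'M[K]_(m, n)) (k0 : int) : Prop :=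
  forall (V V' : int -> 'cV[K]_l) (Y Y' : int -> 'cV[K]_n),
    is_solution F G B k0 V Y -> is_solution F G B k0 V' Y' -> Y k0 = Y' k0 ->
  forall k : int, k0 < k ->
    (forall i : int, k0 <= i <= k -> V i = V' i) -> C *m Y k = C *m Y' k.

Lemma jordan_block0_exp (K : fieldType) (n k : nat) (i j : 'I_n) :
  (jordan_block (0 : K) n ^+ k) i j = ((j : nat) == i + k)%N%:R.
Proof.
elim: k i j => [|k IHk] i j; first by rewrite expr0 mxE addn0 eq_sym.
rewrite exprS mxE; have [lt_in|le_ni] := ltnP i.+1 n.
  rewrite (bigD1 (Ordinal lt_in)) //= mxE mul0rn add0r eqxx mul1r IHk /=.
  rewrite addSnnS big1 ?addr0 // => h /eqP neq_h.
  rewrite mxE mul0rn add0r; case: eqP => [eq_h|_]; last by rewrite mul0r.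
  by case: neq_h; apply: val_inj.
rewrite big1 => [|h _].
  by case: eqP => // eq_j; have := ltn_ord j; rewrite eq_j addnS ltnNge -addSn
    (leq_trans le_ni) ?leq_addr.
rewrite mxE mul0rn add0r; case: eqP => [eq_h|_]; last by rewrite mul0r.
by have := ltn_ord h; rewrite eq_h ltnNge le_ni.
Qed.

Lemma mxdiag_exp (K : fieldType) (r : nat) (s : 'I_r -> nat)
    (A : forall i, 'M[K]_(s i)) (k : nat) :
  (\mxdiag_(i < r) A i) ^+ k = \mxdiag_(i < r) (A i ^+ k).
Proof.
elim: k => [|k IHk].
  by rewrite expr0 -[1]/(1%:M) -mxdiagZ; apply: eq_mxdiag => i; rewrite expr0.
rewrite exprS IHk -[_ * _]/(_ *m _) [X in _ *m X]/mxdiag mul_mxdiag_mxblock.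
apply: eq_mxblock => i j; have [<-|_] := eqVneq i j.
  by rewrite !conform_mx_id exprS.
by rewrite mulmx0.
Qed.

Lemma wqstar_nilpotency_index (K : fieldType) (n : nat) (F G : 'M[K]_n)
    (W : weierstrass F G) (k : nat) :
  (wH W ^+ k == 0) = (wqstar W <= k)%N.
Proof.
rewrite /wH mxdiag_exp -mxdiag0; apply/eqP/bigmax_leqP => [/eq_mxdiagP H0 i _|H0].
  rewrite leqNgt; apply/negP => lt_k.
  have /matrixP/(_ (Ordinal (wqsize_gt0 W i)) (Ordinal lt_k)) := H0 i.
  by rewrite jordan_block0_exp mxE /= eqxx => /eqP; rewrite oner_eq0.
apply: eq_mxdiag => i; apply/matrixP => a b; rewrite jordan_block0_exp mxE.
case: eqP => // eq_b; have := ltn_ord b.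
by rewrite eq_b ltnNge (leq_trans (H0 i isT)) ?leq_addl.
Qed.

(* Main.v *)
(** In the coordinates [Y = Q (Zp, Zq)] the system splits into a forward recursion
    [Zp (k+1) = J Zp k + Bp V k], whose solution only involves past inputs, and
    [H Zq (k+1) = Zq k + Bq V k], whose only solution is
    [Zq k = - \sum_(i < r) H^i Bq V (k+i)] when [H^r = 0]. Hence causality holds as
    soon as [C Qq] kills the terms [i >= 1]. Conversely, an impulse at time
    [k0 + r + i] is invisible in the initial state, and isolates
    [C Qq H^i Bq] in the output at time [k0 + r]. *)
Require Import Defs.
From mathcomp Require Import all_boot all_order all_algebra.

Import Order.TTheory GRing.Theory Num.Theory.
Local Open Scope ring_scope.

Lemma addzS (k : int) (d : nat) : k + d.+1%:Z = k + d%:Z + 1.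
Proof. by rewrite -addrA -PoszD addn1. Qed.

Lemma int_fromP {k0 k : int} : k0 <= k -> exists d : nat, k = k0 + d%:Z.
Proof.
move=> le_k; exists `|k - k0|%N.
by rewrite gez0_abs ?subr_ge0 // addrCA subrr addr0.
Qed.

Lemma int_from_ind (k0 : int) (T : int -> Prop) :
  T k0 -> (forall k, k0 <= k -> T k -> T (k + 1)) -> forall k, k0 <= k -> T k.
Proof.
move=> T0 TS k /int_fromP[d ->].
elim: d => [|d IHd]; first by rewrite addr0.
by rewrite addzS; apply: TS => //; rewrite lerDl.
Qed.

(** By linearity the difference of two solutions solves the system for the difference of their
    inputs, so it suffices to compare with the zero solution. *)
Lemma causal_output_inputP {K : fieldType} {n l m : nat} (F G : 'M[K]_n)
    (B : 'M[K]_(n, l)) (C : 'M[K]_(m, n)) (k0 : int) :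
  causal_output_input F G B C k0 <->
  forall V Y, is_solution F G B k0 V Y -> Y k0 = 0 ->
  forall k, k0 < k -> (forall i, k0 <= i <= k -> V i = 0) -> C *m Y k = 0.
Proof.
split=> [causal V Y solY Y0 k lt_k V0 | causal V V' Y Y' solY solY' Y0 k lt_k VV'].
  rewrite (causal V (fun=> 0) Y (fun=> 0)) ?mulmx0 //.
  by move=> i _; rewrite !mulmx0 addr0.
apply/eqP; rewrite -subr_eq0 -mulmxBr; apply/eqP.
apply: (causal (fun i => V i - V' i) (fun i => Y i - Y' i)) => //.
- move=> i le_i; rewrite !mulmxBr solY // solY' //.
  by rewrite opprD addrACA.
- by rewrite Y0 subrr.
- by move=> i le_i; rewrite VV' // subrr.
Qed.

(** Left multiplication by the invertible [P] is injective, and turns both sides of the system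
    equation into block columns that can be compared blockwise. *)
Lemma is_solution_weierstrass {K : fieldType} {p q l : nat}
    {F G P Q : 'M[K]_(p + q)} {J : 'M[K]_p} {H : 'M[K]_q} (B : 'M[K]_(p + q, l))
    (k0 : int) (V : int -> 'cV[K]_l) (Zp : int -> 'cV[K]_p) (Zq : int -> 'cV[K]_q) :
  P \in unitmx ->
  P *m F *m Q = block_mx 1%:M 0 0 H -> P *m G *m Q = block_mx J 0 0 1%:M ->
  is_solution F G B k0 V (fun k => Q *m col_mx (Zp k) (Zq k)) <->
  forall k, k0 <= k ->
    Zp (k + 1) = J *m Zp k + usubmx (P *m B) *m V k /\
    H *m Zq (k + 1) = Zq k + dsubmx (P *m B) *m V k.
Proof.
move=> P_unit PFQ PGQ.
have step k : F *m (Q *m col_mx (Zp (k + 1)) (Zq (k + 1))) =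
              G *m (Q *m col_mx (Zp k) (Zq k)) + B *m V k <->
    Zp (k + 1) = J *m Zp k + usubmx (P *m B) *m V k /\
    H *m Zq (k + 1) = Zq k + dsubmx (P *m B) *m V k.
  have lhsE : P *m (F *m (Q *m col_mx (Zp (k + 1)) (Zq (k + 1)))) =
      col_mx (Zp (k + 1)) (H *m Zq (k + 1)).
    by rewrite !mulmxA PFQ mul_block_col !mul0mx mul1mx addr0 add0r.
  have rhsE : P *m (G *m (Q *m col_mx (Zp k) (Zq k)) + B *m V k) =
      col_mx (J *m Zp k + usubmx (P *m B) *m V k) (Zq k + dsubmx (P *m B) *m V k).
    rewrite mulmxDr !mulmxA PGQ mul_block_col !mul0mx mul1mx addr0 add0r.
    by rewrite -{1}[P *m B]vsubmxK mul_col_mx add_col_mx.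
  split=> [/(congr1 (mulmx P)) | [Zp1 Zq1]].
    by rewrite lhsE rhsE => /eq_col_mx.
  by apply: (can_inj (mulKmx P_unit)); rewrite lhsE rhsE Zp1 Zq1.
by split=> sol k /sol /step.
Qed.

(** The recursion is read backwards: it expresses [Z k] through [Z (k + 1)], and each substitution
    looks one step further ahead at the cost of one more factor [H]. *)
Lemma fast_state_unroll {K : fieldType} {q : nat} (H : 'M[K]_q) (k0 : int)
    (U Z : int -> 'cV[K]_q) :
  (forall k, k0 <= k -> H *m Z (k + 1) = Z k + U k) ->
  forall (r : nat) k, k0 <= k ->
  Z k = H ^+ r *m Z (k + r%:Z) - \sum_(i < r) H ^+ i *m U (k + i%:Z).
Proof.
move=> solZ r k le_k; elim: r => [|r IHr].
  by rewrite big_ord0 subr0 expr0 mul1mx addr0.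
rewrite big_ord_recr /= {1}IHr exprSr -[_ * H]/(_ *m H) -mulmxA.
rewrite addzS solZ ?(le_trans le_k) ?lerDl //.
by rewrite mulmxDr opprD addrACA subrr addr0.
Qed.

Lemma fast_stateE {K : fieldType} {q : nat} (H : 'M[K]_q) (r : nat) (k0 : int)
    (U Z : int -> 'cV[K]_q) :
  H ^+ r = 0 -> (forall k, k0 <= k -> H *m Z (k + 1) = Z k + U k) ->
  forall k, k0 <= k -> Z k = - \sum_(i < r) H ^+ i *m U (k + i%:Z).
Proof.
move=> Hr0 solZ k le_k.
by rewrite (fast_state_unroll _ _ _ _ solZ r) // Hr0 mul0mx sub0r.
Qed.

Lemma fast_state_solution {K : fieldType} {q : nat} (H : 'M[K]_q) (r : nat)
    (U : int -> 'cV[K]_q) (k : int) :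
  H ^+ r = 0 ->
  H *m (- \sum_(i < r) H ^+ i *m U (k + 1 + i%:Z)) =
  - (\sum_(i < r) H ^+ i *m U (k + i%:Z)) + U k.
Proof.
move=> Hr0.
(* With the vanishing term of index [r] added, the sum at [k] is [U k] plus [H] times the sum at
   [k + 1]. *)
have <- : \sum_(i < r.+1) H ^+ i *m U (k + i%:Z) = \sum_(i < r) H ^+ i *m U (k + i%:Z).
  by rewrite big_ord_recr /= Hr0 mul0mx addr0.
rewrite big_ord_recl /= expr0 mul1mx addr0 opprD addrAC addNr add0r mulmxN mulmx_sumr.
congr (- _); apply: eq_bigr => i _.
by rewrite mulmxA exprS -addrA -PoszD.
Qed.

Lemma slow_state_exists {K : fieldType} {p : nat} (J : 'M[K]_p) (k0 : int)
    (U : int -> 'cV[K]_p) :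
  {Z : int -> 'cV[K]_p | Z k0 = 0 &
    forall k, k0 <= k -> Z (k + 1) = J *m Z k + U k}.
Proof.
(* The recursion runs on the distance to [k0]; the values before [k0] are mirrored and
   irrelevant. *)
pose z := fix z n := if n is n'.+1 then J *m z n' + U (k0 + n'%:Z) else 0.
exists (fun k => z `|k - k0|%N) => [|k le_k]; first by rewrite subrr.
have [d ->] := int_fromP le_k.
by rewrite -addzS ![k0 + _ - k0]addrAC !subrr !add0r.
Qed.

Lemma slow_state_eq0 {K : fieldType} {p : nat} (J : 'M[K]_p) (k0 : int)
    (U Z : int -> 'cV[K]_p) (k : int) :
  Z k0 = 0 -> (forall i, k0 <= i -> Z (i + 1) = J *m Z i + U i) -> k0 <= k ->
  (forall i, k0 <= i < k -> U i = 0) -> Z k = 0.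
Proof.
move=> Z0 solZ; move: k; apply: int_from_ind => // k le_k IHk U0.
rewrite solZ // U0 ?le_k ?ltrDl // addr0 IHk ?mulmx0 // => i /andP[le_i lt_i].
by rewrite U0 // le_i (lt_trans lt_i) ?ltrDl.
Qed.

Lemma causal_weierstrassP {K : fieldType} {p q l m r : nat}
    {F G P Q : 'M[K]_(p + q)} {J : 'M[K]_p} {H : 'M[K]_q}
    (B : 'M[K]_(p + q, l)) (C : 'M[K]_(m, p + q)) (k0 : int) :
  P \in unitmx -> Q \in unitmx ->
  P *m F *m Q = block_mx 1%:M 0 0 H -> P *m G *m Q = block_mx J 0 0 1%:M ->
  H ^+ r = 0 ->
  causal_output_input F G B C k0 <->
  forall i, (i.+1 < r)%N -> C *m (rsubmx Q *m H ^+ i.+1 *m dsubmx (P *m B)) = 0.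
Proof.
move=> P_unit Q_unit PFQ PGQ Hr0; apply: (iff_trans (causal_output_inputP F G B C k0)).
pose Bp := usubmx (P *m B); pose Bq := dsubmx (P *m B).
have outputE zp zq : C *m (Q *m col_mx zp zq) =
    C *m (lsubmx Q *m zp) + C *m (rsubmx Q *m zq).
  by rewrite -{1}[Q]hsubmxK mul_row_col mulmxDr.
split=> [causal i lt_i | Ci0 V Y solY Y0 k lt_k V0].
  apply/matrixP => a b; rewrite [RHS]mxE.
  pose v : 'cV[K]_l := delta_mx b 0.
  (* The impulse comes after [k0 + r - 1], the last time whose input enters [Zq k0], and it enters
     [Zq (k0 + r)] only through the term [j = i.+1]. *)
  pose V k := if k == k0 + (r + i.+1)%N%:Z then v else 0.
  have V0 k : k < k0 + (r + i.+1)%N%:Z -> V k = 0.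
    by rewrite /V => /lt_eqF ->.
  have [Zp Zp0 solZp] := slow_state_exists J k0 (fun k => Bp *m V k).
  pose Zq k := - \sum_(j < r) H ^+ j *m (Bq *m V (k + j%:Z)).
  have : C *m (Q *m col_mx (Zp (k0 + r%:Z)) (Zq (k0 + r%:Z))) = 0.
    apply: (causal V (fun k => Q *m col_mx (Zp k) (Zq k))).
    - apply/(is_solution_weierstrass _ _ _ _ _ P_unit PFQ PGQ) => k le_k.
      split; first exact: solZp.
      exact: (fast_state_solution H r (fun k => Bq *m V k)).
    - rewrite Zp0 /Zq big1 => [|j _]; first by rewrite oppr0 col_mx0 mulmx0.
      by rewrite V0 ?mulmx0 // ltrD2l ltz_nat ltn_addr.
    - by rewrite ltrDl ltz_nat (leq_ltn_trans _ lt_i).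
    - move=> k /andP[_ le_k]; apply: V0; apply: le_lt_trans le_k _.
      by rewrite ltrD2l ltz_nat addnS ltnS leq_addr.
  (* The impulse has not yet reached the slow state at time [k0 + r]. *)
  rewrite outputE (slow_state_eq0 _ _ _ _ _ Zp0 solZp) ?lerDl //; last first.
    move=> k /andP[_ lt_k]; rewrite V0 ?mulmx0 //; apply: lt_trans lt_k _.
    by rewrite ltrD2l ltz_nat addnS ltnS leq_addr.
  rewrite /Zq (bigD1 (Ordinal lt_i)) //= big1 => [|j neq_j]; last first.
    rewrite /V -addrA -PoszD (inj_eq (addrI _)) eqz_nat eqn_add2l.
    by move: neq_j; rewrite -val_eqE /= => /negbTE ->; rewrite !mulmx0.
  rewrite /V -addrA -PoszD eqxx addr0 !mulmx0 add0r !mulmxN !mulmxA.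
  (* Since [v] is a unit vector, the product with it is column [b] of the matrix to be shown
     zero. *)
  move/eqP; rewrite oppr_eq0 => /eqP /matrixP/(_ a 0).
  by rewrite -colE [LHS]mxE [RHS]mxE.
pose Z k := invmx Q *m Y k.
pose Zp k := usubmx (Z k); pose Zq k := dsubmx (Z k).
have YE k' : Y k' = Q *m col_mx (Zp k') (Zq k').
  by rewrite vsubmxK mulKVmx.
have sol : is_solution F G B k0 V (fun k => Q *m col_mx (Zp k) (Zq k)).
  by move=> k' le_k'; rewrite -!YE solY.
move: sol => /(is_solution_weierstrass _ _ _ _ _ P_unit PFQ PGQ) sol.
have le_k := ltW lt_k.
rewrite YE outputE (slow_state_eq0 J k0 (fun k => Bp *m V k) Zp) //; first last.
- by move=> i /andP[le_i lt_i]; rewrite V0 ?le_i ?ltW ?mulmx0.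
- by move=> i /sol[].
- by rewrite /Zp /Z Y0 mulmx0 linear0.
rewrite (fast_stateE H r k0 (fun k => Bq *m V k) Zq) //; last by move=> i /sol[].
(* The term of index 0 involves only [V k], which is zero; the others involve future inputs and are
   killed by [Ci0]. *)
rewrite !mulmx0 add0r !mulmxN !mulmx_sumr big1 ?oppr0 // => -[[|i] lt_i] _ /=.
  by rewrite addr0 V0 ?le_k ?lexx ?mulmx0.
by rewrite !mulmxA -2!(mulmxA C) Ci0 ?mul0mx.
Qed.

Lemma mulmx_col_eq0 {K : fieldType} {m n l : nat} (C : 'M[K]_(m, n))
    (A : 'M[K]_(n, l)) :
  (forall j, C *m col j A = 0) <-> C *m A = 0.
Proof.
split=> [CA0 | CA0 j]; last by rewrite colE mulmxA CA0 mul0mx.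
apply/matrixP => i j; have /matrixP/(_ i 0) := CA0 j.
by rewrite colE mulmxA -colE !mxE.
Qed.

(** With [p] and [q] independent of [n], the equation [e] can be substituted and the casts vanish.
    This cannot be done directly with [wp W] and [wq W], because [W] depends on [n]. *)
Lemma causal_weierstrass_castP {K : fieldType} {n p q l m r : nat} (e : n = (p + q)%N)
    {F G P Q : 'M[K]_n} {J : 'M[K]_p} {H : 'M[K]_q}
    (B : 'M[K]_(n, l)) (C : 'M[K]_(m, n)) (k0 : int) :
  P \in unitmx -> Q \in unitmx ->
  castmx (e, e) (P *m F *m Q) = block_mx 1%:M 0 0 H ->
  castmx (e, e) (P *m G *m Q) = block_mx J 0 0 1%:M ->
  H ^+ r = 0 ->
  causal_output_input F G B C k0 <->
  forall i, (i.+1 < r)%N ->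
    C *m (rsubmx (castmx (erefl n, e) Q) *m H ^+ i.+1 *m
          dsubmx (castmx (e, erefl l) (P *m B))) = 0.
Proof. by subst n; rewrite !castmx_id; apply: causal_weierstrassP. Qed.

Theorem proposition3p3 (K : fieldType) (n l m : nat) (F G : 'M[K]_n)
    (B : 'M[K]_(n, l)) (C : 'M[K]_(m, n)) (k0 : int)
    (F_singular : F \notin unitmx) (FG_regular : regular_pencil F G)
    (W : weierstrass F G) :
  causal_output_input F G B C k0 <->
  (forall j : 'I_(\sum_(i < (wqstar W).-1) l), C *m col j (causality_mx W B) = 0).
Proof.
have Hr0 : wH W ^+ wqstar W = 0 by apply/eqP; rewrite wqstar_nilpotency_index.
apply: (iff_trans (causal_weierstrass_castP (wn W) B C k0 (wP_unit W) (wQ_unit W)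
  (wPFQ W) (wPGQ W) Hr0)).
apply: iff_trans (iff_sym (mulmx_col_eq0 _ _)).
(* The product with a block row vanishes blockwise; block [i] carries the power [i.+1], so the
   ranges [i < (wqstar W).-1] and [i.+1 < wqstar W] have to be matched. *)
rewrite mul_mxrow -[X in _ <-> _ = X]mxrow0; apply: iff_trans (eq_mxrowP _ _).
split=> [Ci0 i | Ci0 i]; first by apply: Ci0; rewrite -ltn_predRL.
by rewrite -ltn_predRL => lt_i; apply: Ci0 (Ordinal lt_i).
Qed.
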